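(* Let $\mathcal A$ be any randomized preemptive online algorithm for $\textsc{Part}$ with $p=2$, and let $R^n_{\mathcal A}$ denote the ratio between the bottleneck value of the partitioning computed by $\mathcal A$ on the all-ones sequence of length $n$ and the optimal bottleneck value $\lceil n/2\rceil$. Then the expected competitive ratio of $\mathcal A$ on all-ones sequences is at least $1.344$, i.e. $\sup_n \mathbb E[R^n_{\mathcal A}]\ge 1.344$.
   Context: $\textsc{Part}$ with $p=2$: a sequence of positive integers arrives online and one separator must be placed so as to split it into two contiguous blocks minimizing the larger block weight (the bottleneck value). In the preemptive online model, upon processing the current request the algorithm may remove its previously placed separator and may place a separator only right after the current request; the length $n$ of the sequence is unknown to the algorithm; when the sequence ends, the separator in place defines the partition. The expectation is over the algorithm's randomness. *)

(* Defs.v *)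
From mathcomp Require Import all_boot all_order all_algebra.
From mathcomp Require Import all_classical all_reals all_analysis.

Set Implicit Arguments.
Unset Strict Implicit.
Unset Printing Implicit Defensive.

Import Order.TTheory GRing.Theory Num.Theory.
Local Open Scope classical_set_scope.
Local Open Scope ring_scope.

(* [Some k] is a separator right after the [k]-th request, [None] means that no
   separator is in place, in which case everything forms a single block. *)
Definition separator := option nat.

Definition bottleneck (s : seq nat) (x : separator) : nat :=
  if x is Some k then maxn (sumn (take k s)) (sumn (drop k s)) else sumn s.

(* A block may be empty, as is unavoidable when [size s = 1]. *)
Definition opt_bottleneck (s : seq nat) : nat :=
  \big[minn/sumn s]_(k < (size s).+1) bottleneck s (Some (k : nat)).

Definition positive_requests (s : seq nat) : bool := all (ltn 0) s.

(* [sep s] is the separator in place once exactly the requests of [s] have been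
   processed. It depends on [s] only, hence neither on future requests nor on
   the total length. *)
Record online_alg := OnlineAlg {
  sep :> seq nat -> separator;
  sep_nil : sep [::] = None;
  sep_rcons : forall (s : seq nat) (w : nat), positive_requests (rcons s w) ->
    [\/ sep (rcons s w) = sep s,
        sep (rcons s w) = None
      | sep (rcons s w) = Some (size s).+1] }.

(* The algorithm draws all its randomness as one point of a sample space [T],
   so the random choices made at different steps may be correlated. *)
Record randomized_online_alg (d : measure_display) (T : measurableType d) :=
  RandomizedOnlineAlg {
    run :> T -> online_alg;
    run_measurable : forall (s : seq nat) (x : separator),
      positive_requests s -> measurable [set w | run w s = x] }.

Definition competitive_ratio (R : realType) (s : seq nat) (a : online_alg) : R :=
  (bottleneck s (a s))%:R / (opt_bottleneck s)%:R.

Definition ones (n : nat) : seq nat := nseq n 1%N.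

Definition expected_ratio_on_ones (R : realType) (d : measure_display)
    (T : measurableType d) (P : probability T R)
    (A : randomized_online_alg T) (n : nat) : \bar R :=
  'E_P[fun w => competitive_ratio R (ones n) (A w)]%E.

Lemma bottleneck_ones n k : (k <= n)%N ->
  bottleneck (ones n) (Some k) = maxn k (n - k).
Proof.
by move=> kn; rewrite /= take_nseq // drop_nseq !sumn_nseq !mul1n.
Qed.

Lemma opt_bottleneck_ones n : opt_bottleneck (ones n) = uphalf n.
Proof.
apply/eqP; rewrite eqn_leq; apply/andP; split.
  have hn : (uphalf n <= n)%N by rewrite leq_uphalf_double -addnn leq_addr.
  have hk : (uphalf n < (size (ones n)).+1)%N by rewrite size_nseq ltnS.
  apply: (@bigmin_inf _ nat _ _ (Ordinal hk) xpredT) => //.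
  rewrite [leLHS]bottleneck_ones // leEnat geq_max leqnn /= leq_subLR.
  by rewrite addnn -leq_uphalf_double.
rewrite /opt_bottleneck; elim/big_ind: _ => [|x y hx hy|k _].
- by rewrite sumn_nseq mul1n leq_uphalf_double -addnn leq_addr.
- by rewrite leq_min hx.
have kn : (k <= n)%N by rewrite -ltnS -[X in (_ < X.+1)%N](size_nseq n 1%N).
rewrite bottleneck_ones // leq_uphalf_double -addnn -{1}(subnKC kn).
by rewrite leq_add // ?leq_maxl ?leq_maxr.
Qed.

(* Main.v *)
Require Import Defs.
From mathcomp Require Import all_boot all_order all_algebra.
From mathcomp Require Import all_classical all_reals all_analysis.
From mathcomp Require Import measurable_realfun ring lra zify.

Import Order.TTheory GRing.Theory Num.Theory.
Local Open Scope classical_set_scope.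
Local Open Scope ring_scope.

(* Yao's principle with weight 1/n on the all-ones sequence of length n. In the
   continuous limit, a separator placed at s and kept until time r s costs
   2 ln (r / 2) + 2 / r for r >= 2 (and 2 - 2 / r for r <= 2), against a total
   weight ln r; the quotient is minimal near r = 61/20 and always exceeds 82/61,
   which is slightly more than 1.344. The excess of this cost over 82/61 * ln r
   is nonnegative and vanishes at r = 1, so it serves as a potential: for every
   deterministic algorithm the weighted ratios up to time n sum to at least
   82/61 * ln n - 2, whereas the weights sum to at most 1 + ln n. *)

(** * Numerical bounds on e and on logarithms *)

Lemma expR1_lower_bound (R : realType) : 163 / 60 <= expR 1 :> R.
Proof.
(* 163/60 = 1 + 1 + 1/2 + 1/6 + 1/24 + 1/120. *)
have -> : 163 / 60 = series (exp_coeff (1 : R)) 6.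
  rewrite /series /= exp_coeffE !big_nat_recr //= big_geq //.
  have -> : (2`! = 2)%N by [].
  have -> : (3`! = 6)%N by [].
  have -> : (4`! = 24)%N by [].
  have -> : (5`! = 120)%N by [].
  by rewrite !expr1n fact0 (_ : 1`! = 1)%N//; lra.
apply: (nondecreasing_cvgn_le _ (is_cvg_series_exp_coeff (1 : R))).
by apply/nondecreasing_seqP => n; rewrite seriesSr lerDl exp_coeff_ge0.
Qed.

Lemma ler_lnB1 {R : realType} (x : R) : 0 < x -> ln x <= x - 1.
Proof.
by move=> x0; rewrite -[in leLHS](subrKC 1 x) le_ln1Dx// ltrBDr addrC subrr.
Qed.

Lemma ln_tangent {R : realType} (a x : R) :
  0 < a -> 0 < x -> ln x <= ln a + (x / a - 1).
Proof.
move=> a0 x0; rewrite -lerBlDl -ln_div ?posrE//.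
by rewrite ler_lnB1// divr_gt0.
Qed.

(** This is nonnegativity of the second branch of [surplus] at 61/20, multiplied by 61/2. *)
Lemma ln2_upper_bound (R : realType) :
  61 * ln 2 <= 20 * (1 + ln (61 / 20)) :> R.
Proof.
have a0 : 0 < expR 1 * (61 / 160) :> R by rewrite mulr_gt0 ?expR_gt0//; lra.
(* The factor 8 absorbs 60 of the 61 copies of [ln 2]; what remains is 2 <= (61 e / 160)^20, shown
   below by repeated squaring with rounded-down rationals. *)
have -> : 61 / 20 = 61 / 160 * 2 ^+ 3 :> R by rewrite !exprS expr0; lra.
rewrite lnM ?posrE ?exprn_gt0//.
rewrite lnXn// addrA -[X in X + ln _ + _](expRK 1) -lnM ?posrE ?expR_gt0//.
  suff : ln 2 <= 20 * ln (expR 1 * (61 / 160)) :> R by lra.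
  rewrite mulr_natl -lnXn// ler_ln ?posrE ?exprn_gt0//.
  set y := expR 1 * _.
  have y1 : 2071 / 2000 <= y by have := expR1_lower_bound R; rewrite /y; lra.
  have y2 : 193 / 180 <= y ^+ 2 by rewrite expr2; nra.
  have y4 : 1149 / 1000 <= y ^+ 4 by rewrite (exprM y 2 2) [leRHS]expr2; nra.
  have y5 : 2379 / 2000 <= y ^+ 5 by rewrite exprS; nra.
  have y10 : 2829 / 2000 <= y ^+ 10 by rewrite (exprM y 5 2) [leRHS]expr2; nra.
  by rewrite (exprM y 10 2) [leRHS]expr2; nra.
Qed.

(** Equivalent to 2^7 <= e^5; it serves the tangent at 2 in [surplus_ge0]. *)
Lemma ln2_le_5_7 (R : realType) : ln 2 <= 5 / 7 :> R.
Proof.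
suff : 7 * ln 2 <= 5 :> R by lra.
rewrite mulr_natl -lnXn// -[leRHS](mulr1 5) -[X in _ * X](expRK 1).
rewrite mulr_natl -lnXn ?expR_gt0// ler_ln ?posrE ?exprn_gt0 ?expR_gt0//.
have := expR1_lower_bound R; move: (expR 1) => y y1.
have y2 : 72 / 10 <= y ^+ 2 by rewrite expr2; nra.
have y4 : 51 <= y ^+ 4 by rewrite (exprM y 2 2) [leRHS]expr2; nra.
have -> : (2 : R) ^+ 7 = 128 by rewrite !exprS expr0; lra.
by rewrite exprS; nra.
Qed.

(** * The surplus function and its growth per request *)

(* The constant is 82/61 = 2 - 2/(61/20), which makes 61/20 the critical point
   of the second branch. *)
Definition surplus {R : realType} (t : R) : R :=
  (if t <= 2 then 2 - 2 / t else 2 * ln (t / 2) + 2 / t) - 82 / 61 * ln t.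

Lemma surplus1 {R : realType} : surplus 1 = 0 :> R.
Proof. by rewrite /surplus ler1n/= divr1 ln1; lra. Qed.

Lemma surplus_le2 {R : realType} (t : R) : t <= 2 ->
  surplus t = 2 - 2 / t - 82 / 61 * ln t.
Proof. by rewrite /surplus => ->. Qed.

Lemma surplus_ge2 {R : realType} (t : R) : 2 <= t ->
  surplus t = 2 * ln (t / 2) + 2 / t - 82 / 61 * ln t.
Proof.
rewrite /surplus le_eqVlt => /predU1P[<-|]; last by rewrite ltNge => /negPf->.
by rewrite lexx divff// ln1; lra.
Qed.

Lemma surplus_ge0 {R : realType} (t : R) : 1 <= t -> 0 <= surplus t.
Proof.
move=> t1; have t0 : 0 < t by lra.
have tV : t * t^-1 = 1 by rewrite divff// gt_eqF.
have tV0 : 0 < t^-1 by rewrite invr_gt0.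
have [t2|/ltW t2] := leP t 2.
  (* With the tangent of [ln] at 1 the bound becomes (t - 1) (2/t - 82/61) >= 0, which holds up to t
     = 61/41; beyond that the tangent at 2 is used. *)
  rewrite surplus_le2//; have [t3|t3] := leP t (61 / 41).
    have ht := ler_lnB1 t t0.
    have : 82 / 61 * (t - 1) <= 2 - 2 / t by nra.
    lra.
  have ht := ln_tangent 2 t ltac:(lra) t0; have h2 := ln2_le_5_7 R.
  have : 82 / 61 * (5 / 7 + (t / 2 - 1)) <= 2 - 2 / t by nra.
  lra.
rewrite surplus_ge2//.
(* This bounds [ln t] from below; the terms in 1/t then cancel, leaving [ln2_upper_bound]. *)
have := ln_tangent t (61 / 20) t0 ltac:(lra).
have := ln2_upper_bound R.
rewrite ln_div ?posrE//.
lra.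
Qed.

Lemma ln_succ_bounds {R : realType} (n : nat) : (0 < n)%N ->
  n.+1%:R^-1 <= ln n.+1%:R - ln (n%:R : R) <= n%:R^-1.
Proof.
move=> n0; have n0R : 0 < n%:R :> R by rewrite ltr0n.
have n1R : 0 < n.+1%:R :> R by rewrite ltr0n.
have h1 := ln_tangent n%:R n.+1%:R n0R n1R.
have h2 := ln_tangent n.+1%:R n%:R n1R n0R.
have e1 : n.+1%:R / n%:R = 1 + n%:R^-1 :> R.
  by rewrite -natr1 mulrDl divff ?gt_eqF// mul1r.
have e2 : n%:R / n.+1%:R = 1 - n.+1%:R^-1 :> R.
  by rewrite -[n%:R](addrK 1) natr1 mulrBl divff ?gt_eqF// mul1r.
rewrite e1 in h1; rewrite e2 in h2.
move: h1 h2; move: (n.+1%:R : R) => y h1 h2.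
by apply/andP; split; lra.
Qed.

(** The [ln] terms with factor 82/61 cancel. The last summand pays for discretization: it telescopes
    over n, and lifts 2/(n+1) to 2/n, which dominates the increment of 2 ln. *)
Lemma surplus_step {R : realType} (s n : nat) : (0 < s <= n)%N ->
  surplus (n.+1%:R / s%:R) + 82 / 61 * (ln n.+1%:R - ln n%:R) <=
  surplus (n%:R / s%:R) + 2 * (maxn s (n - s))%:R / n.+1%:R / n%:R
  + 2 * (n%:R^-1 - n.+1%:R^-1) :> R.
Proof.
move=> /andP[s0 sn].
have n0 : (0 < n)%N := leq_trans s0 sn.
have /andP[_ lnS] := @ln_succ_bounds R n n0.
have s0R : 0 < s%:R :> R by rewrite ltr0n.
have n0R : 0 < n%:R :> R by rewrite ltr0n.
have n1R : 0 < n.+1%:R :> R by rewrite ltr0n.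
have nV : n%:R^-1 - n.+1%:R^-1 = (n.+1%:R)^-1 / n%:R :> R.
  by field; rewrite -natr1 in n1R *; rewrite !gt_eqF.
have V0 : 0 < n%:R^-1 - n.+1%:R^-1 :> R by rewrite nV divr_gt0 ?invr_gt0.
(* By integrality n/s and (n+1)/s lie on the same side of 2, so both use the same branch of
   [surplus]. *)
have [ns|ns] := leqP n.+1 (2 * s).
  have -> : maxn s (n - s) = s by apply/maxn_idPl; lia.
  have nsR : n.+1%:R <= 2 * s%:R :> R by rewrite -natrM ler_nat.
  have nsR' : n%:R <= 2 * s%:R :> R by rewrite -natrM ler_nat ltnW.
  rewrite !surplus_le2 ?ler_pdivrMr//.
  rewrite !invf_div !ln_div ?posrE//.
  rewrite -[_ / n.+1%:R / _]mulrA -nV.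
  by move: lnS V0; move: (n.+1%:R : R) => y lnS V0; lra.
have -> : maxn s (n - s) = (n - s)%N by apply/maxn_idPr; lia.
have nsR : 2 * s%:R <= n%:R :> R by rewrite -natrM ler_nat.
have nsR' : 2 * s%:R <= n.+1%:R :> R by rewrite -natrM ler_nat leqW.
rewrite !surplus_ge2 ?ler_pdivlMr//.
rewrite !invf_div !ln_div ?posrE ?divr_gt0// natrB//.
have -> : 2 * (n%:R - s%:R) / n.+1%:R / n%:R =
          2 * n.+1%:R^-1 - 2 * s%:R * (n%:R^-1 - n.+1%:R^-1) :> R.
  by rewrite nV; field; rewrite -natr1 in n1R *; rewrite !gt_eqF.
by move: lnS V0; move: (n.+1%:R : R) => y lnS V0; lra.
Qed.

(** * Amortized analysis of a deterministic algorithm *)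

Lemma onesS (n : nat) : ones n.+1 = rcons (ones n) 1%N.
Proof. by rewrite /ones -cats1 -[[:: 1%N]]/(nseq 1 1%N) -nseqD addn1. Qed.

Lemma positive_ones (n : nat) : positive_requests (ones n).
Proof. by rewrite /positive_requests all_nseq orbT. Qed.

Lemma sep_onesS (a : online_alg) (n : nat) :
  [\/ a (ones n.+1) = a (ones n), a (ones n.+1) = None
    | a (ones n.+1) = Some n.+1].
Proof.
have := @sep_rcons a (ones n) 1%N; rewrite -onesS size_nseq; apply.
exact: positive_ones.
Qed.

Lemma sep_ones_range (a : online_alg) (n k : nat) :
  a (ones n) = Some k -> (0 < k <= n)%N.
Proof.
elim: n => [|n IHn]; first by rewrite sep_nil.
case: (sep_onesS a n) => -> => [/IHn/andP[-> /leqW]|//|[<-]]//.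
by rewrite leqnn.
Qed.

(** No separator counts 0, the same as one just placed, since [surplus 1 = 0]. *)
Definition potential (R : realType) (a : online_alg) (n : nat) : R :=
  if a (ones n) is Some k then surplus (n%:R / k%:R) else 0.

Lemma ratio_ones_ge (R : realType) (a : online_alg) (n : nat) : (0 < n)%N ->
  2 * (bottleneck (ones n) (a (ones n)))%:R / n.+1%:R <=
  competitive_ratio R (ones n) a.
Proof.
move=> n0; rewrite /competitive_ratio opt_bottleneck_ones.
have u0 : (0 < uphalf n)%N by case: n n0.
rewrite ler_pdivrMr ?ltr0n// mulrAC ler_pdivlMr ?ltr0n//.
rewrite [leLHS]mulrAC [leRHS]mulrC ler_wpM2r// -natrM ler_nat.
by rewrite uphalfE; lia.
Qed.

Lemma potential_ge0 (R : realType) (a : online_alg) (n : nat) :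
  0 <= potential R a n.
Proof.
rewrite /potential; case E: (a (ones n)) => [k|//].
have /andP[k0 kn] := sep_ones_range _ _ _ E.
by apply: surplus_ge0; rewrite ler_pdivlMr ?ltr0n// mul1r ler_nat.
Qed.

Lemma potential_step (R : realType) (a : online_alg) (n : nat) : (0 < n)%N ->
  potential R a n.+1 + 82 / 61 * (ln n.+1%:R - ln n%:R) <=
  potential R a n + competitive_ratio R (ones n) a / n%:R
  + 2 * (n%:R^-1 - n.+1%:R^-1).
Proof.
move=> n0; have n0R : 0 < n%:R :> R by rewrite ltr0n.
apply: (@le_trans _ _ (potential R a n
    + 2 * (bottleneck (ones n) (a (ones n)))%:R / n.+1%:R / n%:R
    + 2 * (n%:R^-1 - n.+1%:R^-1))); last first.
  by rewrite lerD2r lerD2l ler_wpM2r ?invr_ge0 ?ler0n ?ratio_ones_ge.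
(* The potential if the separator stays; removing or moving it gives 0, which is no larger. *)
pose kept : R := if a (ones n) is Some k then surplus (n.+1%:R / k%:R) else 0.
apply: (@le_trans _ _ (kept + 82 / 61 * (ln n.+1%:R - ln n%:R))).
  rewrite lerD2r /potential /kept.
  have kept_ge0 : 0 <= kept.
    rewrite /kept; case E: (a (ones n)) => [k|//].
    have /andP[k0 kn] := sep_ones_range _ _ _ E.
    by rewrite surplus_ge0// ler_pdivlMr ?ltr0n// mul1r ler_nat leqW.
  by case: (sep_onesS a n) => ->; rewrite ?divff ?surplus1.
rewrite /kept /potential; case E: (a (ones n)) => [k|].
  have kn := sep_ones_range _ _ _ E.
  rewrite bottleneck_ones; last by case/andP: kn.
  exact: surplus_step.
(* Without a separator, cost and slack add up to 2/n, more than 82/61 times the increment of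
   [ln]. *)
have /andP[_ lnS] := @ln_succ_bounds R n n0.
have nV := invr_gt0 (n%:R : R).
have -> : bottleneck (ones n) None = n by rewrite /= sumn_nseq mul1n.
have -> : 2 * n%:R / n.+1%:R / n%:R = 2 * n.+1%:R^-1 :> R.
  by rewrite [LHS]mulrAC mulfK// gt_eqF.
by rewrite n0R in nV; move: lnS nV; move: (n.+1%:R : R) => y lnS nV; lra.
Qed.

Lemma weighted_ratio_ge (R : realType) (a : online_alg) (n : nat) :
  82 / 61 * ln n.+1%:R - 2 <=
  \sum_(1 <= k < n.+1) competitive_ratio R (ones k) a / k%:R.
Proof.
(* The induction carries the potential and the exact telescoped slack; both are dropped
   afterwards. *)
suff : 82 / 61 * ln n.+1%:R + potential R a n.+1 - 2 * (1 - n.+1%:R^-1) <=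
    \sum_(1 <= k < n.+1) competitive_ratio R (ones k) a / k%:R.
  have := potential_ge0 R a n.+1.
  have : 0 <= n.+1%:R^-1 :> R by rewrite invr_ge0.
  by move: (n.+1%:R : R) => y; lra.
elim: n => [|n IHn].
  rewrite big_geq// ln1 invr1 /potential.
  by case: (sep_onesS a 0) => ->; rewrite ?sep_nil ?divff ?surplus1//; lra.
rewrite big_nat_recr//=.
have := potential_step R a n.+1 ltac:(done).
by move: (n.+1%:R : R) (n.+2%:R : R) IHn => y z; lra.
Qed.

Lemma harmonic_le_ln (R : realType) (n : nat) : (0 < n)%N ->
  \sum_(1 <= k < n.+1) k%:R^-1 <= 1 + ln n%:R :> R.
Proof.
elim: n => // -[_ _|n IHn _]; first by rewrite big_nat1 ln1 invr1; lra.
rewrite big_nat_recr//=; have := IHn ltac:(done).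
have /andP[+ _] := @ln_succ_bounds R n.+1 ltac:(done).
by move: (n.+1%:R : R) (n.+2%:R : R) => y z; lra.
Qed.

(** * Passage to expectations *)

Lemma measurable_ratio_ones (R : realType) (d : measure_display)
    (T : measurableType d) (A : randomized_online_alg T) (n : nat) :
  measurable_fun setT (fun w => competitive_ratio R (ones n) (A w)).
Proof.
move=> _ Y mY; rewrite setTI.
pose ratio (x : separator) : R :=
  (bottleneck (ones n) x)%:R / (opt_bottleneck (ones n))%:R.
(* Separators form a countable type, so the preimage is a countable union of events of the form in
   [run_measurable]. *)
rewrite (_ : _ @^-1` Y =
  \bigcup_(x in [set x | Y (ratio x)]) [set w | A w (ones n) = x]).
  rewrite bigcup_mkcond; apply: countable_bigcupT_measurable => [|x].
    exact: (@countableP (option nat)).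
  by case: ifP => // _; exact: run_measurable (positive_ones n).
apply/seteqP; split => w /=; first by exists (A w (ones n)).
by case=> x Yx /= Ex; rewrite /competitive_ratio Ex.
Qed.

Theorem theorem4 (R : realType) (d : measure_display) (T : measurableType d)
    (P : probability T R) (A : randomized_online_alg T) :
  ((1344 / 1000 : R)%:E <=
    ereal_sup [set expected_ratio_on_ones P A n | n in [set n | (0 < n)%N]])%E.
Proof.
rewrite leNgt; apply/negP => sup_lt.
set c : R := 1344 / 1000 in sup_lt.
have E_le k : (0 < k)%N -> (expected_ratio_on_ones P A k <= c%:E)%E.
  by move=> k0; apply/ltW/(le_lt_trans _ sup_lt)/ereal_sup_ubound; exists k.
(* The two bounds below would give (82/61 - c) ln (n+1) <= c + 2 < 4, which this choice of n
   contradicts. *)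
pose n := Num.bound (expR (4 / (82 / 61 - c))).
have ln_n : 4 / (82 / 61 - c) <= ln n.+1%:R.
  rewrite -[leLHS]expRK ler_ln ?posrE ?expR_gt0//.
  apply: (@le_trans _ _ n%:R); last by rewrite ler_nat.
  by apply/ltW/archi_boundP/ltW/expR_gt0.
pose f k w := ((competitive_ratio R (ones k) (A w) / k%:R)%:E : \bar R).
have f_ge0 k w : (0 <= f k w)%E.
  by rewrite lee_fin !divr_ge0.
have mf k : measurable_fun setT (f k).
  apply/measurable_EFinP; apply: measurable_funM => //.
  exact: measurable_ratio_ones.
have upper :
  (\int[P]_w (\sum_(1 <= k < n.+2) f k w) <= (c * (1 + ln n.+1%:R))%:E)%E.
  rewrite ge0_integral_sum//.
  apply: (@le_trans _ _ (\sum_(1 <= k < n.+2) (c * k%:R^-1)%:E)%E).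
    rewrite big_nat [leRHS]big_nat; apply: lee_sum => k /andP[k0 _].
    rewrite /f; under eq_integral do rewrite mulrC EFinM.
    rewrite ge0_integralZl_EFin ?invr_ge0//; last 2 first.
    - by move=> w _; rewrite lee_fin divr_ge0.
    - by apply/measurable_EFinP; exact: measurable_ratio_ones.
    rewrite [in leRHS]mulrC EFinM lee_wpmul2l ?lee_fin ?invr_ge0//.
    by have := E_le k k0; rewrite /expected_ratio_on_ones unlock.
  rewrite sumEFin lee_fin -mulr_sumr ler_wpM2l ?harmonic_le_ln//.
  by rewrite /c; lra.
have lower :
  ((82 / 61 * ln n.+1%:R - 2)%:E <= \int[P]_w (\sum_(1 <= k < n.+2) f k w))%E.
  (* The integral comparison is for nonnegative functions, so a nonpositive constant is treated
     apart. *)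
  have [neg|pos] := leP (82 / 61 * ln n.+1%:R - 2 : R) 0.
    apply: (@le_trans _ _ 0%E); first by rewrite lee_fin.
    by apply: integral_ge0 => w _; apply: sume_ge0 => k _.
  rewrite -[leLHS]mule1 -(probability_setT P) -integral_cst//.
  apply: ge0_le_integral => //.
  - by move=> w _; rewrite lee_fin ltW.
  - exact: emeasurable_sum.
  - move=> w _; rewrite sumEFin lee_fin.
    apply: le_trans (weighted_ratio_ge R (A w) n.+1).
    by rewrite lerD2r ler_pM2l ?ler_ln ?posrE ?ler_nat//; lra.
have := le_trans lower upper; rewrite lee_fin.
have c0 : 0 < 82 / 61 - c by rewrite /c; lra.
by move: ln_n; rewrite ler_pdivrMr// /c; lra.
Qed.
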